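(* Let $G$ be a complex simple Lie group of type $ADE$, $B\subseteq P\subseteq G$ a Borel and a parabolic subgroup, $\pi:G/B\to G/P$ the projection, and $\mathcal T_{G/P}:=\pi^*T_{G/P}$. For every homogeneous variety $G/P$ the homogeneous bundle $\mathcal T_{G/P}$ on $G/B$ is multiplicity free and connected.
   Context: The following is applied to the homogeneous variety $G/B$, with $E=\mathcal T_{G/P}$. Let $\mathfrak b=\operatorname{Lie}B=\mathfrak h\oplus\mathfrak n$, with $\mathfrak h$ the Cartan subalgebra and $\mathfrak n$ the sum of the positive root spaces. Homogeneous bundles on $G/B$ (bundles with a $G$-action compatible with that on $G/B$) correspond to representations of $B$. For a weight $\lambda$, $E_\lambda$ is the homogeneous line bundle given by the character $\lambda$. Quiver $\mathcal Q_{G/B}$: the vertices are the weights $\lambda$; there is an arrow $\lambda\to\mu$ iff $\operatorname{Hom}(\mathfrak n\otimes E_\lambda,E_\mu)^G\ne0$ (invariant homomorphisms, i.e. $\mathfrak h$-equivariant maps, $\mathfrak n$ carrying the adjoint action of $\mathfrak h$). For a homogeneous bundle $E$, $\operatorname{gr}E$ is $E$ viewed as an $\mathfrak h$-module, $\operatorname{gr}E=\bigoplus_\lambda E_\lambda\otimes V_\lambda$. The associated representation $[E]$ assigns $V_\lambda$ to $\lambda$, and to each arrow $\lambda\to\mu$ the component $g_{\lambda\mu}\in\operatorname{Hom}(V_\lambda,V_\mu)$ of the $\mathfrak n$-action $\theta:\mathfrak n\otimes\operatorname{gr}E\to\operatorname{gr}E$, written as $\theta=\sum g_{\lambda\mu}f_{\lambda\mu}$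 with $f_{\lambda\mu}$ a fixed generator of the one-dimensional space $\operatorname{Hom}(\mathfrak n\otimes E_\lambda,E_\mu)^G$. $\mathcal Q|_E$ is the subquiver given by all vertices where $[E]$ is non-zero and all arrows connecting any two such vertices. $E$ is multiplicity free if every non-zero $V_\lambda$ has dimension $1$; $E$ is connected if $\mathcal Q|_E$ is connected. *)

(* Defs.v *)
From HB Require Import structures.
From Stdlib Require Import Relation_Operators.
From mathcomp Require Import all_boot all_order all_algebra all_fingroup.
From mathcomp Require Import reals complex.

Set Implicit Arguments.
Unset Strict Implicit.
Unset Printing Implicit Defensive.

Import GRing.Theory.
Local Open Scope ring_scope.

(* Everything is expressed through the differential of the group picture: the  *)
(* Lie algebra L of G, the subalgebras Lie B and Lie P, and representations of *)
(* Lie B in place of homogeneous bundles on G/B.                               *)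

HB.mixin Record Vector_isLieAlgebra (K : fieldType) L of Vector K L := {
  lie_bracket : L -> L -> L;
  lie_bracket_linearl : forall y, linear (fun x => lie_bracket x y);
  lie_bracket_linearr : forall x, linear (lie_bracket x);
  lie_bracketxx : forall x, lie_bracket x x = 0;
  lie_jacobi : forall x y z,
    lie_bracket x (lie_bracket y z) + lie_bracket y (lie_bracket z x)
      + lie_bracket z (lie_bracket x y) = 0
}.

#[short(type="lieAlgType")]
HB.structure Definition LieAlgebra (K : fieldType) :=
  { L of Vector_isLieAlgebra K L & Vector K L }.

Notation "[[ x , y ]]" := (lie_bracket x y) (format "[[ x ,  y ]]").

Section LieAlgebra.
Context {K : fieldType} {L : lieAlgType K}.
Implicit Types (x y z : L) (U h b p : {vspace L}).

HB.instance Definition _ x :=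
  GRing.isLinear.Build K L L *:%R (lie_bracket x) (lie_bracket_linearr x).

Lemma lie_bracketC x y : [[x, y]] = - [[y, x]].
Proof.
have Dl u v w : [[u + v, w]] = [[u, w]] + [[v, w]].
  by have := lie_bracket_linearl w 1 u v; rewrite !scale1r.
apply/eqP; rewrite -addr_eq0; apply/eqP.
have := lie_bracketxx (x + y).
by rewrite Dl !raddfD /= !lie_bracketxx add0r addr0.
Qed.

Definition ad_def x : 'End(L) := linfun (lie_bracket x).

Fact ad_def_linear : linear ad_def.
Proof.
move=> a x y; apply/lfunP => z.
by rewrite add_lfunE scale_lfunE !lfunE /= lie_bracket_linearl.
Qed.
HB.instance Definition _ :=
  GRing.isLinear.Build K L 'End(L) *:%R ad_def ad_def_linear.

Definition ad : 'Hom(L, 'End(L)) := linfun ad_def.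

Lemma adE x y : ad x y = [[x, y]].
Proof. by rewrite !lfunE. Qed.

Lemma ad_bracket x y : ad [[x, y]] = (ad x \o ad y)%VF - (ad y \o ad x)%VF.
Proof.
apply/lfunP => z; rewrite add_lfunE opp_lfunE !comp_lfunE !adE.
have /eqP := lie_jacobi x y z; rewrite (lie_bracketC z [[x, y]]) subr_eq0.
by move=> /eqP <-; rewrite (lie_bracketC z x) raddfN.
Qed.

Definition subalgebra U : Prop := {in U &, forall x y, [[x, y]] \in U}.

Definition ideal U : Prop := forall x y, y \in U -> [[x, y]] \in U.

End LieAlgebra.

Definition simple_lie (K : fieldType) (L : lieAlgType K) : Prop :=
  (exists x y : L, [[x, y]] <> 0) /\
  (forall I : {vspace L}, ideal I -> I = 0%VS \/ I = fullv).

Section CartanSubalgebra.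
Context {K : fieldType} {L : lieAlgType K}.

Definition ad_semisimple (t : L) : Prop :=
  exists2 X : seq L, basis_of fullv X &
    {in X, forall x, exists a : K, [[t, x]] = a *: x}.

(* The usual definition inside a complex semisimple Lie algebra (Helgason):    *)
(* maximal among the abelian subalgebras, with ad-semisimple elements.         *)
Definition cartan_subalgebra (h : {vspace L}) : Prop :=
  [/\ {in h &, forall s t, [[s, t]] = 0},
      (forall h' : {vspace L}, {in h' &, forall s t, [[s, t]] = 0} ->
         (h <= h')%VS -> h' = h) &
      {in h, forall t, ad_semisimple t}].

End CartanSubalgebra.

Definition weight (K : fieldType) (L : vectType K) (h : {vspace L}) :=
  'Hom(subvs_of h, K^o).

(* As for mx_representation, the action is a total function, constrained only  *)
(* on the subalgebra b; its values off b are irrelevant.                       *)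
Record lie_module (K : fieldType) (L : lieAlgType K) (b : {vspace L}) :=
  LieModule {
    lmod_sort :> vectType K;
    lmod_act : 'Hom(L, 'End(lmod_sort));
    lmod_actP : {in b &, forall x y, lmod_act [[x, y]] =
      (lmod_act x \o lmod_act y)%VF - (lmod_act y \o lmod_act x)%VF}
  }.

Section Weights.
Context {K : fieldType} {L : lieAlgType K} (h : {vspace L}).

Definition weight_space (V : vectType K) (rho : 'Hom(L, 'End(V)))
    (l : weight h) : {vspace V} :=
  (\bigcap_(t <- vbasis h) passmx.leigenspace (rho t) (l (vsproj h t)))%VS.

Lemma weight_spaceP (V : vectType K) (rho : 'Hom(L, 'End(V)))
    (l : weight h) (v : V) :
  reflect (forall t : subvs_of h, rho (vsval t) v = l t *: v)
          (v \in weight_space rho l).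
Proof.
apply: (iffP idP) => [wv t | wv].
  have wvb i : rho (vbasis h)`_i v = l (vsproj h (vbasis h)`_i) *: v.
    have [lti|gei] := ltnP i (\dim h); last first.
      by rewrite nth_default ?size_tuple // !linear0 zero_lfunE scale0r.
    have bi : (vbasis h)`_i \in vbasis h by rewrite mem_nth ?size_tuple.
    move: wv; rewrite /weight_space (big_rem _ bi) /= => /memv_capP[+ _].
    by rewrite memv_ker add_lfunE opp_lfunE scale_lfunE id_lfunE subr_eq0
      => /eqP.
  rewrite -[t in RHS]vsvalK (coord_vbasis (subvsP t)) !linear_sum /=.
  rewrite sum_lfunE scaler_suml; apply: eq_bigr => i _.
  by rewrite !linearZ /= scale_lfunE wvb scalerA.
rewrite /weight_space big_seq.
elim/big_ind: _ => [|U W Uv Wv|t bt]; rewrite ?memvf //.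
  exact/memv_capP.
rewrite memv_ker add_lfunE opp_lfunE scale_lfunE id_lfunE subr_eq0.
by rewrite -wv vsprojK // vbasis_mem.
Qed.

Definition root_space (a : weight h) : {vspace L} := weight_space ad a.

Definition is_root (a : weight h) : bool :=
  (a != 0) && (root_space a != 0%VS).

Definition nonneg_comb n (D : n.-tuple (weight h)) (a : weight h) : Prop :=
  exists c : 'I_n -> nat, a = \sum_(i < n) tnth D i *+ c i.

Definition simple_roots n (D : n.-tuple (weight h)) : Prop :=
  [/\ free D, {in D, forall a, is_root a} &
      forall a, is_root a -> nonneg_comb D a \/ nonneg_comb D (- a)].

Definition positive_root n (D : n.-tuple (weight h)) (a : weight h) : Prop :=
  is_root a /\ nonneg_comb D a.

(* nn is the sum of the positive root spaces; Phi enumerates the (finitely     *)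
(* many) positive roots.                                                       *)
Definition positive_part n (D : n.-tuple (weight h)) (nn : {vspace L}) : Prop :=
  exists Phi : seq (weight h),
    (forall a, a \in Phi <-> positive_root D a) /\
    nn = (\sum_(a <- Phi) root_space a)%VS.

Definition coroot (a : weight h) (t : subvs_of h) : Prop :=
  a t = 2%:R /\
  exists e f : L,
    [/\ e \in root_space a, f \in root_space (- a) & vsval t = [[e, f]]].

(* c = <a, b^vee>                                                              *)
Definition cartan_integer (a b : weight h) (c : int) : Prop :=
  exists2 t : subvs_of h, coroot b t & a t = c%:~R.

End Weights.

(* Edges of the simply laced Dynkin diagrams, with Bourbaki's numbering        *)
(* shifted to start at 0.                                                      *)
Inductive dynkinADE := DynkinA | DynkinD | DynkinE.

Definition dynkin_rank (X : dynkinADE) (n : nat) : bool :=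
  match X with
  | DynkinA => (1 <= n)%N
  | DynkinD => (4 <= n)%N
  | DynkinE => (6 <= n <= 8)%N
  end.

Definition dynkin_edge (X : dynkinADE) (n i j : nat) : bool :=
  match X with
  | DynkinA => j == i.+1
  | DynkinD => (j == i.+1) && (j < n.-1)%N || (i == n - 3)%N && (j == n.-1)
  | DynkinE => (i, j) \in
      [:: (0, 2); (1, 3); (2, 3); (3, 4); (4, 5); (5, 6); (6, 7)]%N
  end.

Definition dynkin_cartan (X : dynkinADE) (n : nat) : 'M[int]_n :=
  \matrix_(i, j) (if i == j then 2%:Z
                  else if dynkin_edge X n i j || dynkin_edge X n j i then - 1%:Z
                  else 0).

Definition type_ADE (K : fieldType) (L : lieAlgType K) (h : {vspace L}) n
    (D : n.-tuple (weight h)) : Prop :=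
  exists X : dynkinADE, dynkin_rank X n /\
  exists s : 'S_n, forall i j,
    cartan_integer (tnth D (s i)) (tnth D (s j)) (dynkin_cartan X n i j).

Section Quotient.
Context {K : fieldType} {V : vectType K} (U : {vspace V}).

(* The quotient V / U, carried by the complement U^C chosen by the library.    *)
Definition quot := subvs_of (U^C)%VS.

Definition quot_proj : 'Hom(V, quot) :=
  (linfun (vsproj (U^C)%VS) \o daddv_pi (U^C)%VS U)%VF.

Definition quot_end (f : 'End(V)) : 'End(quot) :=
  (quot_proj \o f \o linfun vsval)%VF.

Fact quot_end_linear : linear quot_end.
Proof.
move=> a f g; apply/lfunP => v.
rewrite add_lfunE scale_lfunE /quot_end !comp_lfunE add_lfunE scale_lfunE.
by rewrite !linearP.
Qed.
HB.instance Definition _ :=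
  GRing.isLinear.Build K 'End(V) 'End(quot) *:%R quot_end quot_end_linear.

Let capCU : ((U^C :&: U) = 0)%VS.
Proof. by rewrite capvC capv_compl. Qed.

Lemma quot_proj_val (v : quot) : quot_proj (vsval v) = v.
Proof.
by rewrite comp_lfunE lfunE /= daddv_pi_id ?subvsP // vsvalK.
Qed.

Lemma val_quot_proj v : vsval (quot_proj v) = v - daddv_pi U (U^C)%VS v.
Proof.
rewrite comp_lfunE lfunE /= vsprojK ?memv_pi //.
apply/eqP; rewrite -subr_eq opprK; apply/eqP.
by rewrite daddv_pi_add // addvC addv_complf memvf.
Qed.

Lemma lker_quot_proj : lker quot_proj = U.
Proof.
apply/vspaceP => v; rewrite memv_ker; apply/eqP/idP => [pv0 | Uv].
  have /eqP := val_quot_proj v; rewrite pv0 linear0 eq_sym subr_eq0 => /eqP ->.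
  exact: memv_pi.
apply: subvs_inj; rewrite val_quot_proj daddv_pi_id ?capv_compl //.
by rewrite subrr linear0.
Qed.

Lemma quot_endE (f : 'End(V)) :
  {in U, forall v, f v \in U} ->
  forall v, quot_end f (quot_proj v) = quot_proj (f v).
Proof.
move=> fU v; pose u := daddv_pi U (U^C)%VS v.
have -> : quot_end f (quot_proj v) = quot_proj (f (v - u)).
  rewrite -val_quot_proj /quot_end; move: (quot_proj v) => w.
  by rewrite !comp_lfunE [linfun _ w]lfunE.
suff pfu0 : quot_proj (f u) = 0 by rewrite !linearB /= pfu0 subr0.
by apply/eqP; rewrite -memv_ker lker_quot_proj fU // memv_pi.
Qed.

End Quotient.

Section Tangent.
Context {K : fieldType} {L : lieAlgType K}.

(* A standard parabolic subalgebra: one that contains the Borel subalgebra b.  *)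
Definition parabolic (b p : {vspace L}) : Prop := subalgebra p /\ (b <= p)%VS.

(* The pullback of T_{G/P} to G/B is the representation of B on the tangent    *)
(* space Lie G / Lie P of G/P at the base point, induced by the adjoint action.*)
Definition tangent_act (p : {vspace L}) : 'Hom(L, 'End(quot p)) :=
  (linfun (quot_end p) \o ad)%VF.

Lemma tangent_actE (p : {vspace L}) (x y : L) : subalgebra p -> x \in p ->
  tangent_act p x (quot_proj p y) = quot_proj p [[x, y]].
Proof.
move=> subp px; rewrite /tangent_act comp_lfunE [linfun _ _]lfunE /=.
by rewrite quot_endE ?adE // => v pv; rewrite adE subp.
Qed.

Fact tangent_actP (b p : {vspace L}) : parabolic b p ->
  {in b &, forall x y, tangent_act p [[x, y]] =
    (tangent_act p x \o tangent_act p y)%VF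
      - (tangent_act p y \o tangent_act p x)%VF}.
Proof.
move=> [subp /subvP bp] x y /bp px /bp py; apply/lfunP => v.
rewrite add_lfunE opp_lfunE.
rewrite (comp_lfunE (tangent_act p x)) (comp_lfunE (tangent_act p y)).
rewrite -[v]quot_proj_val !tangent_actE ?subp // -linearB /=.
congr (quot_proj p _).
by rewrite -adE ad_bracket add_lfunE opp_lfunE !comp_lfunE !adE.
Qed.

Definition tangent_bundle (b p : {vspace L}) (bp : parabolic b p) :
  lie_module b := LieModule (tangent_actP bp).

End Tangent.

(* Quivers without multiple arrows.                                            *)
Record quiver := Quiver { vertex : Type; arrow : vertex -> vertex -> Prop }.

Definition full_subquiver (Q : quiver) (S : pred (vertex Q)) : quiver :=
  Quiver (fun x y : {v : vertex Q | S v} => arrow (proj1_sig x) (proj1_sig y)).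

(* Connectedness of the underlying undirected graph; the empty quiver, which   *)
(* arises from the point G/G, counts as connected.                             *)
Definition quiver_connected (Q : quiver) : Prop :=
  forall x y : vertex Q, clos_refl_sym_trans (vertex Q) (@arrow Q) x y.

Section HomogeneousQuiver.
Context {K : fieldType} {L : lieAlgType K} (h nn : {vspace L}).

(* The space E_l is the line K^o on which t in h acts by l t, and a linear map *)
(* from nn (x) E_l to E_m is given in curried form.                            *)
Definition equivariant (l m : weight h)
    (f : 'Hom(subvs_of nn, 'Hom(K^o, K^o))) : Prop :=
  forall (t : subvs_of h) (x : subvs_of nn) (v : K^o),
    f (vsproj nn [[vsval t, vsval x]]) v + f x (l t *: v) = m t *: f x v.

Definition homogeneous_quiver : quiver :=
  Quiver (fun l m : weight h => exists2 f, equivariant l m f & f <> 0).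

Definition support (b : {vspace L}) (E : lie_module b) : pred (weight h) :=
  fun l => weight_space (lmod_act E) l != 0%VS.

Definition multiplicity_free (b : {vspace L}) (E : lie_module b) : Prop :=
  forall l : weight h, support E l -> \dim (weight_space (lmod_act E) l) = 1%N.

Definition bundle_quiver (b : {vspace L}) (E : lie_module b) : quiver :=
  full_subquiver (Q := homogeneous_quiver) (support E).

Definition connected (b : {vspace L}) (E : lie_module b) : Prop :=
  quiver_connected (bundle_quiver E).

End HomogeneousQuiver.

(* Main.v *)
From HB Require Import structures.
Require Import Defs.
From Stdlib Require Import Relation_Operators.
From mathcomp Require Import all_boot all_order all_algebra all_fingroup.
From mathcomp Require Import reals complex boolp.
From mathcomp Require Import zify.

(** The weights of [Lie G / Lie P] are the roots [l] whose root space is not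
    contained in [Lie P]; since [Lie P] contains [h] and the positive root spaces,
    they are negative. Multiplicity freeness is therefore the fact that root spaces
    are lines, and connectedness is a matter of joining negative roots by steps
    along simple roots.

    The root spaces are handled without the Killing form. The type ADE hypothesis
    provides an sl2-triple [e, f, t] for each simple root [a]. For any weight [b]
    with [b t > 0], the operator [x |-> [e, [f, x]]] is injective, hence bijective,
    on the root space of [b] ([sl2_lower_raise_inj]): otherwise the vectors
    [ad e ^ k v] would be non-zero for all [k], whereas there are finitely many
    weights. Consequently [ad f] embeds the root space of [b] into that of [b - a],
    and [ad e] maps the latter onto the former. Moreover the image of this operator
    on the root space of [a] is contained in the line of [e], because [h] is its own
    centralizer; so that root space is this line, and coroots are unique.

    Positivity of the simply laced Cartan matrices ([dynkin_cartan_positive]) gives,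
    for each non-zero sum [b] of simple roots, a simple root [a] that occurs in [b]
    and whose coroot is positive on [b]. By induction on the number of simple roots
    in [b], its root space has dimension at most 1 ([cone_root_dim]) and is
    generated by the simple root vectors ([cone_root_generated]). Changing all signs
    yields the same for the negative roots.

    For connectedness, let [v] be a root vector killed by all the lowering operators
    [ad f]. What the raising operators [ad e] generate from [v] is an ideal, hence
    everything since the Lie algebra is simple ([lowest_vector_generates]). Let [M]
    be the sum of [Lie P] and of the root spaces of the weights of [Lie G / Lie P]
    that are joined to the weight of [v]. It contains [v], and it is stable under
    the raising operators, because raising by a simple root is an arrow of the
    quiver ([root_arrow]). So [M] is everything, and every weight of
    [Lie G / Lie P] is joined to that of [v]. *)

Set Implicit Arguments.
Unset Strict Implicit.
Unset Printing Implicit Defensive.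

Import Order.TTheory GRing.Theory Num.Theory.
Local Open Scope ring_scope.

(** * Joint eigenvectors *)

Section JointEigenvectors.
Context {K : fieldType} {V : vectType K}.

(** Joint eigenvectors with pairwise distinct eigensystems are independent; the
    eigensystems are indexed by [W] and the operators by [I]. *)
Lemma joint_eigen_indep (I : Type) (W : eqType) (T : I -> 'End(V))
    (ev : W -> I -> K) (A : seq W) (x : W -> V) :
    (forall l m, l <> m -> exists i, ev l i <> ev m i) -> uniq A ->
    {in A, forall l i, T i (x l) = ev l i *: x l} ->
    \sum_(l <- A) x l = 0 -> {in A, forall l, x l = 0}.
Proof.
move=> sep; elim: A x => // a A IH x /= /andP[aA uA] Tx s0.
have xA : {in A, forall l, x l = 0}.
  move=> l lA.
  have /sep[i neq] : l <> a by move=> la; rewrite -la lA in aA.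
  have /IH : {in A, forall m j, T j ((ev m i - ev a i) *: x m)
                                = ev m j *: ((ev m i - ev a i) *: x m)}.
    move=> m mA j; rewrite linearZ /= Tx ?in_cons ?mA ?orbT //.
    by rewrite !scalerA mulrC.
  move=> /(_ uA); rewrite -(_ : T i (\sum_(m <- a :: A) x m)
      - ev a i *: (\sum_(m <- a :: A) x m) = \sum_(m <- A) _); last first.
    rewrite linear_sum /= scaler_sumr !big_cons Tx ?mem_head // opprD.
    rewrite addrACA subrr add0r -sumrB.
    apply: eq_big_seq => m mA; rewrite Tx ?in_cons ?mA ?orbT //.
    by rewrite scalerBl.
  rewrite s0 linear0 scaler0 subrr => /(_ erefl) /(_ l lA) /eqP.
  by rewrite scaler_eq0 subr_eq0 => /orP[/eqP|/eqP].
move=> l; rewrite in_cons => /orP[/eqP ->|/xA //].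
by move: s0; rewrite big_cons big_seq big1 ?addr0 // => m /xA.
Qed.

(** A joint eigenvector written as a sum of joint eigenvectors with distinct
    eigensystems is the summand with its own eigensystem. *)
Lemma joint_eigen_component (I : Type) (W : eqType) (T : I -> 'End(V))
    (ev : W -> I -> K) (A : seq W) (x : W -> V) (m : W) (v : V) :
    (forall l m, l <> m -> exists i, ev l i <> ev m i) -> uniq A ->
    {in A, forall l i, T i (x l) = ev l i *: x l} ->
    (forall i, T i v = ev m i *: v) ->
    v = \sum_(l <- A) x l -> v = if m \in A then x m else 0.
Proof.
move=> sep uA Tx Tv vE.
pose B := if m \in A then A else m :: A.
pose y l := (if l \in A then x l else 0) - (if l == m then v else 0).
have uB : uniq B by rewrite /B; case: ifP => //= ->.
have mB : m \in B by rewrite /B; case: ifP; rewrite ?mem_head.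
have yB : {in B, forall l i, T i (y l) = ev l i *: y l}.
  move=> l _ i; rewrite /y linearB scalerBr /=; congr (_ - _).
    by case: ifP => lA; [rewrite Tx | rewrite linear0 scaler0].
  by case: eqP => [->|_]; [rewrite Tv | rewrite linear0 scaler0].
have sy : \sum_(l <- B) y l = 0.
  rewrite sumrB [X in _ - X](bigD1_seq m) //= eqxx.
  rewrite [X in v + X]big1 ?addr0 => [|l /negPf -> //].
  rewrite vE; apply/eqP; rewrite subr_eq0; apply/eqP; rewrite /B.
  case: ifP => mA; rewrite ?big_cons ?mA ?add0r;
    by apply: eq_big_seq => l ->.
have := joint_eigen_indep sep uB yB sy mB.
by rewrite /y eqxx => /eqP; rewrite subr_eq0 => /eqP.
Qed.

Lemma memv_sum_seqP (W : eqType) (A : seq W) (U : W -> {vspace V}) v :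
    uniq A -> v \in (\sum_(a <- A) U a)%VS ->
  exists2 x : W -> V, {in A, forall a, x a \in U a} & v = \sum_(a <- A) x a.
Proof.
elim: A v => [|a A IH] v /= => [_|/andP[aA uA] ].
  by rewrite big_nil memv0 => /eqP ->; exists (fun=> 0); rewrite ?big_nil.
rewrite big_cons => /memv_addP[u uU [w /(IH _ uA)[x xU ->] ->] ].
exists (fun b => if b == a then u else x b) => [b|].
  by rewrite in_cons; case: eqP => [-> |_ /xU].
rewrite big_cons eqxx; congr (_ + _); apply: eq_big_seq => b bA.
by case: eqP => // ba; rewrite -ba bA in aA.
Qed.

(** Refining a vector along a diagonalisable operator [T] keeps it a joint
    eigenvector of the operators that commute with [T]. *)
Lemma split_eigenvector (T : 'End(V)) (X : seq V) (v : V) :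
    (fullv <= <<X>>)%VS -> {in X, forall x, exists a, T x = a *: x} ->
  exists2 Y : seq V, v = \sum_(y <- Y) y &
    {in Y, forall y, (exists a, T y = a *: y) /\
      forall (S : 'End(V)) (b : K), (S \o T)%VF = (T \o S)%VF ->
        S v = b *: v -> S y = b *: y}.
Proof.
move=> fX Xe.
have [A uA fA] : exists2 A : seq K, uniq A &
    (fullv <= \sum_(a <- A) lker (T - a *: \1%VF))%VS.
  have [A0 A0P] : exists A0 : seq K,
      {in X, forall x, exists2 a, a \in A0 & T x = a *: x}.
    elim: X Xe {fX} => [|x X IH] Xe; first by exists [::].
    have [y yX|A0 A0P] := IH; first by apply: Xe; rewrite in_cons yX orbT.
    have [a xa] := Xe x (mem_head _ _).
    exists (a :: A0) => y; rewrite in_cons => /orP[/eqP ->|/A0P[b bA yb] ].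
      by exists a; rewrite ?mem_head.
    by exists b; rewrite // in_cons bA orbT.
  exists (undup A0); first exact: undup_uniq.
  apply: subv_trans fX _; apply/span_subvP => x /A0P[a aA xa].
  rewrite (big_rem a) ?mem_undup //= -[x]addr0 memv_add ?mem0v //.
  by rewrite memv_ker add_lfunE opp_lfunE scale_lfunE id_lfunE xa subrr.
have /(memv_sum_seqP uA)[x xU vE] := subvP fA v (memvf v).
have Tx a : a \in A -> T (x a) = a *: x a.
  move=> /xU; rewrite memv_ker add_lfunE opp_lfunE scale_lfunE id_lfunE.
  by rewrite subr_eq0 => /eqP.
exists (map x A); first by rewrite big_map.
move=> _ /mapP[a aA ->]; split=> [|S b ST Sv]; first by exists a; apply: Tx.
suff S0 : {in A, forall a, S (x a) - b *: x a = 0}.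
  by apply/eqP; rewrite -subr_eq0 S0.
have sep (l m : K) : l <> m -> exists _ : unit, l <> m by exists tt.
have SxE : {in A, forall l (_ : unit), T (S (x l) - b *: x l)
                                       = l *: (S (x l) - b *: x l)}.
  move=> l lA _; have /lfunP/(_ (x l)) := ST; rewrite !comp_lfunE => STl.
  by rewrite linearB linearZ /= -STl Tx // linearZ /= scalerBr !scalerA mulrC.
apply: (joint_eigen_indep sep uA SxE).
by rewrite sumrB -linear_sum -scaler_sumr -vE /= Sv subrr.
Qed.

(** Commuting diagonalisable operators are simultaneously diagonalisable. *)
Lemma joint_eigenvectors_span (Ts : seq 'End(V)) :
    {in Ts &, forall S T : 'End(V), (S \o T)%VF = (T \o S)%VF} ->
    {in Ts, forall T : 'End(V), exists2 X : seq V, basis_of fullv X &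
      {in X, forall x, exists a, T x = a *: x}} ->
  exists2 X : seq V, (fullv <= <<X>>)%VS &
    {in X, forall x, {in Ts, forall T : 'End(V), exists a, T x = a *: x}}.
Proof.
elim: Ts => [_ _|T Ts IH comm diag].
  by exists (vbasis fullv) => //; rewrite (span_basis (vbasisP _)) subvv.
have [||X fX Xe] := IH.
- by move=> S S' ST S'T; apply: comm; rewrite in_cons ?ST ?S'T orbT.
- by move=> S ST; apply: diag; rewrite in_cons ST orbT.
have [Y bY Ye] := diag T (mem_head _ _).
have fY : (fullv <= <<Y>>)%VS by rewrite (span_basis bY) subvv.
suff [Z XZ Ze] : exists2 Z : seq V, {subset X <= <<Z>>%VS} &
    {in Z, forall x, {in T :: Ts, forall T : 'End(V), exists a, T x = a *: x}}.
  by exists Z => //; apply: subv_trans fX _; apply/span_subvP.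
elim: X Xe {fX} => [|x X IHX] Xe; first by exists [::].
have [y yX|Z XZ Ze] := IHX; first by apply: Xe; rewrite in_cons yX orbT.
have [Y' xE Y'e] := split_eigenvector x fY Ye.
exists (Y' ++ Z) => y; rewrite ?span_cat ?mem_cat.
  rewrite in_cons => /orP[/eqP ->|/XZ yZ].
    rewrite -[x]addr0 memv_add ?mem0v // xE big_seq memv_suml // => z.
    exact: memv_span.
  by rewrite -[y]add0r memv_add ?mem0v.
case/orP => [yY S|/Ze]; last by [].
  rewrite in_cons => /orP[/eqP ->|ST].
  by have [] := Y'e y yY.
have [b Sx] := Xe x (mem_head _ _) S ST.
exists b; have [_] := Y'e y yY; apply => //.
by apply: comm; rewrite in_cons ?eqxx ?ST ?orbT.
Qed.

(** A predicate closed under linear combinations is membership in a subspace: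
    one of maximal dimension among those on which it holds. *)
Lemma vspace_of_pred (P : V -> Prop) :
    P 0 -> (forall a u v, P u -> P v -> P (a *: u + v)) ->
  exists U : {vspace V}, forall v, v \in U <-> P v.
Proof.
move=> P0 Plin.
pose sub d := `[< exists2 U : {vspace V}, (forall v, v \in U -> P v) & \dim U = d >].
have ex : exists d, sub d.
  exists 0%N; apply/asboolP; exists 0%VS; rewrite ?dimv0 // => v.
  by rewrite memv0 => /eqP ->.
have bd d : sub d -> (d <= \dim (fullv : {vspace V}))%N.
  by case/asboolP => U _ <-; rewrite dimvS ?subvf.
case: (ex_maxnP ex bd) => d /asboolP[U UP dU] dmax.
exists U => v; split=> [/UP //|Pv].
have UvP w : w \in (<[v]> + U)%VS -> P w.
  case/memv_addP => u0 /vlineP[a ->] [u /UP Pu ->].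
  exact: Plin.
have UUv : (U <= <[v]> + U)%VS by rewrite addvSr.
suff /eqP -> : U == (<[v]> + U)%VS.
  exact: subvP (addvSl _ _) _ (memv_line v).
rewrite -(dimv_leqif_eq UUv) eqn_leq dimvS //= dU.
apply: dmax.
by apply/asboolP; exists (<[v]> + U)%VS.
Qed.

End JointEigenvectors.

(** * Brackets and root spaces *)

Section Brackets.
Context {K : fieldType} {L : lieAlgType K}.
Implicit Types x y z : L.

Lemma lie_bracketDl x y z : [[x + y, z]] = [[x, z]] + [[y, z]].
Proof. by have := lie_bracket_linearl z 1 x y; rewrite !scale1r. Qed.

Lemma lie_bracketDr x y z : [[x, y + z]] = [[x, y]] + [[x, z]].
Proof. exact: linearD. Qed.

Lemma lie_bracketZr a x y : [[x, a *: y]] = a *: [[x, y]].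
Proof. exact: linearZ. Qed.

Lemma lie_bracketNr x y : [[x, - y]] = - [[x, y]].
Proof. exact: linearN. Qed.

Lemma lie_bracket0r x : [[x, 0]] = 0.
Proof. exact: linear0. Qed.

Lemma lie_bracketZl a x y : [[a *: x, y]] = a *: [[x, y]].
Proof. by rewrite lie_bracketC lie_bracketZr -scalerN -lie_bracketC. Qed.

Lemma lie_bracket0l x : [[0, x]] = 0.
Proof. by rewrite lie_bracketC lie_bracket0r oppr0. Qed.

Lemma lie_bracketNl x y : [[- x, y]] = - [[x, y]].
Proof. by rewrite lie_bracketC lie_bracketNr -lie_bracketC. Qed.

Lemma lie_bracket_derivation x y z :
  [[x, [[y, z]]]] = [[[[x, y]], z]] + [[y, [[x, z]]]].
Proof.
have := lie_jacobi x y z.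
rewrite (lie_bracketC z x) (lie_bracketC z [[x, y]]) lie_bracketNr.
by move/eqP; rewrite subr_eq0 subr_eq addrC => /eqP ->; rewrite addrC.
Qed.

End Brackets.

Section Weights.
Context {K : fieldType} {L : lieAlgType K} (h : {vspace L}).
Implicit Types (l m : weight h) (t : subvs_of h) (x y : L).

Lemma weight_separation l m : l <> m -> exists t, l t <> m t.
Proof.
move=> lm; apply: contrapT => no; apply: lm; apply/lfunP => t.
by apply: contrapT => lt; apply: no; exists t.
Qed.

Lemma weight_component (V : vectType K) (rho : 'Hom(L, 'End(V)))
    (A : seq (weight h)) (x : weight h -> V) m (v : V) :
    uniq A -> {in A, forall l, x l \in weight_space rho l} ->
    v \in weight_space rho m -> v = \sum_(l <- A) x l ->
  v = if m \in A then x m else 0.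
Proof.
move=> uA xA vm; apply: (joint_eigen_component
  (T := fun t => rho (vsval t)) (ev := fun l t => l t)) => //.
- exact: weight_separation.
- by move=> l lA t; move/weight_spaceP: (xA l lA); apply.
- by apply/weight_spaceP.
Qed.

Lemma root_spaceP l x :
  reflect (forall t, [[vsval t, x]] = (l t : K) *: x) (x \in root_space l).
Proof.
by apply: (iffP (weight_spaceP _ _ _)) => H t; have := H t; rewrite adE.
Qed.

Lemma root_space_bracket (a b : weight h) x y :
  x \in root_space a -> y \in root_space b -> [[x, y]] \in root_space (a + b).
Proof.
move=> /root_spaceP ax /root_spaceP yb; apply/root_spaceP => t.
rewrite lie_bracket_derivation ax yb lie_bracketZl lie_bracketZr -scalerDl.
by rewrite add_lfunE.
Qed.

Lemma mem_root_space_eq (a b : weight h) x :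
  a = b -> x \in root_space a -> x \in root_space b.
Proof. by move->. Qed.

Lemma vspace0P (V : vectType K) (U : {vspace V}) :
  reflect (exists2 x, x \in U & x != 0) (U != 0%VS).
Proof.
apply: (iffP idP) => [nz|[x xU x0] ].
  by exists (vpick U); rewrite ?memv_pick ?vpick0.
by apply: contra x0 => /eqP U0; rewrite -memv0 -U0.
Qed.

End Weights.

Section RootDecomposition.
Context {K : fieldType} {L : lieAlgType K} (h : {vspace L}).
Hypothesis cartan_h : cartan_subalgebra h.
Implicit Types (l m : weight h) (t : subvs_of h) (x y : L).

(** A Cartan subalgebra is its own centralizer, by maximality. *)
Lemma root_space0 : root_space (0 : weight h) = h.
Proof.
have [abel max _] := cartan_h.
apply/vspaceP => x; apply/idP/idP => [/root_spaceP x0|xh]; last first.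
  by apply/root_spaceP => t; rewrite zero_lfunE scale0r abel ?subvsP.
have cx s : s \in h -> [[s, x]] = 0.
  by move=> sh; have := x0 (vsproj h s); rewrite vsprojK // zero_lfunE scale0r.
have <- : (h + <[x]>)%VS = h.
  apply: max; last exact: addvSl.
  move=> u v /memv_addP[s sh [u0 /vlineP[a ->] ->] ].
  move=> /memv_addP[t th [v0 /vlineP[b ->] ->] ].
  rewrite lie_bracketDl !lie_bracketDr !lie_bracketZr !lie_bracketZl abel //.
  rewrite lie_bracketxx (lie_bracketC x t) !cx //.
  by rewrite oppr0 !scaler0 !addr0.
exact: subvP (addvSr _ _) _ (memv_line x).
Qed.

(** Eigenvalues for the vectors of a basis of [h] extend to a weight. *)
Lemma joint_eigenvector_weight x :
    {in vbasis h, forall s, exists a, [[s, x]] = a *: x} ->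
  exists l, x \in root_space l.
Proof.
move=> xe.
have [a aE] : exists a : 'I_(\dim h) -> K,
    forall i : 'I_(\dim h), [[(vbasis h)`_i, x]] = a i *: x.
  apply: (fin_all_exists (P := fun (i : 'I_(\dim h)) (a : K) =>
    [[(vbasis h)`_i, x]] = a *: x)) => i.
  by apply: xe; rewrite mem_nth ?size_tuple.
pose l : weight h := \sum_i a i *:
  (linfun (coord (vbasis h) i : L -> K^o) \o linfun vsval)%VF.
exists l; apply/root_spaceP => t.
rewrite sum_lfunE {1}(coord_vbasis (subvsP t)) scaler_suml.
rewrite lie_bracketC -lie_bracketNr -sumrN linear_sum /=.
apply: eq_bigr => i _.
rewrite lie_bracketNr -lie_bracketC lie_bracketZl aE scale_lfunE.
by rewrite comp_lfunE !lfunE /= scalerA mulrC.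
Qed.

(** The root space decomposition, indexed by the finitely many weights of [h]
    on the Lie algebra, [0] included. *)
Lemma root_decomposition : exists2 A : seq (weight h),
  uniq A & fullv = (\sum_(l <- A) root_space l)%VS.
Proof.
have [abel _ ss] := cartan_h.
have [||X fX Xe] := @joint_eigenvectors_span _ _ (map ad (vbasis h)).
- move=> _ _ /mapP[s sh ->] /mapP[t th ->]; apply/eqP.
  rewrite -subr_eq0 -ad_bracket abel ?linear0 //; exact: vbasis_mem.
- move=> _ /mapP[s sh ->]; have [X bX Xe] := ss s (vbasis_mem sh).
  by exists X => // x /Xe[a xa]; exists a; rewrite adE.
have [A AX] : exists A : seq (weight h), (<<X>> <= \sum_(l <- A) root_space l)%VS.
  elim: X Xe {fX} => [|x X IH] Xe; first by exists [::]; rewrite span_nil sub0v.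
  have [y yX|A AX] := IH; first by apply: Xe; rewrite in_cons yX orbT.
  have [s sh|l xl] := @joint_eigenvector_weight x.
    by have [|a] := Xe x (mem_head _ _) (ad s); rewrite ?map_f // adE; exists a.
  exists (l :: A); rewrite span_cons big_cons addvS //.
exists (undup A); first exact: undup_uniq.
apply/eqP; rewrite eqEsubv subvf andbT (subv_trans fX) // (subv_trans AX) //.
elim: A {AX} => [|l A IH] /=; first by rewrite big_nil sub0v.
rewrite big_cons; case: ifP => lA; last by rewrite big_cons addvS.
by rewrite subv_add IH andbT (big_rem l) ?mem_undup //= addvSl.
Qed.

Lemma weight_mem A l x : uniq A -> fullv = (\sum_(m <- A) root_space m)%VS ->
  x \in root_space l -> x != 0 -> l \in A.
Proof.
move=> uA fA xl; have : x \in (fullv : {vspace L}) := memvf x.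
rewrite fA => /(memv_sum_seqP uA)[y yA xE].
by have := weight_component uA yA xl xE; case: ifP => // _ ->; rewrite eqxx.
Qed.

Lemma root_space_eventually0 (u : nat -> weight h) :
  injective u -> exists k, root_space (u k) = 0%VS.
Proof.
move=> uI; apply: contrapT => no; have [A uA fA] := root_decomposition.
have sub : {subset map u (iota 0 (size A).+1) <= A}.
  move=> _ /mapP[k _ ->].
  have /vspace0P[x xk x0] : root_space (u k) != 0%VS.
    by apply/eqP => uk; apply: no; exists k.
  exact: weight_mem xk x0.
have := uniq_leq_size _ sub; rewrite map_inj_uniq // iota_uniq => /(_ isT).
by rewrite size_map size_iota ltnn.
Qed.

(** The weight spaces of [L / p] are the images of the root spaces. *)
Lemma tangent_weight_space (p : {vspace L}) l :
    subalgebra p -> (h <= p)%VS ->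
  weight_space (tangent_act p) l = (quot_proj p @: root_space l)%VS.
Proof.
move=> subp /subvP hp.
have proj_weight m x : x \in root_space m ->
    quot_proj p x \in weight_space (tangent_act p) m.
  move=> /root_spaceP xm; apply/weight_spaceP => t.
  by rewrite tangent_actE ?hp ?subvsP // xm linearZ.
apply/vspaceP => v; apply/idP/memv_imgP => [vl|[x xl ->] ]; last exact: proj_weight.
have [A uA fA] := root_decomposition.
have : vsval v \in (fullv : {vspace L}) := memvf _.
rewrite fA => /(memv_sum_seqP uA)[x xA vE].
have vE' : v = \sum_(m <- A) quot_proj p (x m).
  by rewrite -linear_sum -vE /= quot_proj_val.
have /weight_component : {in A, forall m,
    quot_proj p (x m) \in weight_space (tangent_act p) m}.
  by move=> m mA; apply/proj_weight/xA.
move=> /(_ l v uA vl vE'); case: ifP => [lA ->|_ ->].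
  by exists (x l); rewrite ?xA.
by exists 0; rewrite ?mem0v ?linear0.
Qed.

End RootDecomposition.

(** * sl2-triples *)

Section Sl2.
Context {K : numFieldType} {L : lieAlgType K} (h : {vspace L}).
Hypothesis cartan_h : cartan_subalgebra h.
Implicit Types (a b : weight h) (t : subvs_of h) (x y e f v : L).

(** [e], [f] and [t] span a copy of sl2, with [e] of weight [a]. The element [t]
    has the type of the elements of [h], so that weights apply to it. *)
Definition sl2_triple a e f t : Prop :=
  [/\ e \in root_space a, f \in root_space (- a), vsval t = [[e, f]] & a t = 2%:R].

Lemma sl2_triple_opp a e f t : sl2_triple a e f t -> sl2_triple (- a) f e (- t).
Proof.
move=> [ea fa tE at2]; split; rewrite ?opprK //.
  by rewrite linearN /= tE -lie_bracketC.
by rewrite opp_lfunE linearN opprK.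
Qed.

Lemma weight_natmul a k t : (a *+ k) t = (a t : K) *+ k.
Proof.
by elim: k => [|k IH]; rewrite ?mulr0n ?zero_lfunE // !mulrS add_lfunE IH.
Qed.

(** On a weight space where the coroot is positive, lowering and then raising is
    injective. If it kills [v], then lowering brings [ad e ^ k.+1 v] back to a
    negative multiple of [ad e ^ k v] for every [k]; so no [ad e ^ k v] vanishes,
    against the finiteness of the set of weights. *)
Lemma sl2_lower_raise_inj a b e f t v :
    sl2_triple a e f t -> 0 < (b t : K) -> v \in root_space b ->
  [[e, [[f, v]]]] = 0 -> v = 0.
Proof.
move=> [ea fa tE at2] bt vb efv; apply/eqP; apply: contrapT => /negP v0.
pose w k := iter k (lie_bracket e) v.
have wb k : w k \in root_space (b + a *+ k).
  elim: k => [|k IH]; first by rewrite mulr0n addr0.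
  by rewrite mulrS addrCA; exact: (root_space_bracket ea IH).
have tw k : [[vsval t, w k]] = ((b t : K) + (2 * k)%:R) *: w k.
  move/root_spaceP: (wb k) => ->; congr (_ *: _).
  by rewrite add_lfunE weight_natmul at2 natrM mulr_natr.
(* The coefficients satisfy [c 0 = b t] and [c k.+1 = c k + b t + 2 (k + 1)]. *)
have fw k : exists2 c : K, 0 < c & [[f, w k.+1]] = - c *: w k.
  have step j : [[f, w j.+1]] =
      - ((b t : K) + (2 * j)%:R) *: w j + [[e, [[f, w j]]]].
    rewrite /= lie_bracket_derivation; congr (_ + _).
    by rewrite (lie_bracketC f e) -tE lie_bracketNl tw scaleNr.
  elim: k => [|k [c c0 IH] ]; first by exists (b t); rewrite // step efv muln0 !addr0.
  exists (b t + (2 * k.+1)%:R + c); first by rewrite !addr_gt0 // ltr0n.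
  by rewrite step IH lie_bracketZr (_ : lie_bracket e (w k) = w k.+1) // -scalerDl -opprD.
have w0 k : w k != 0.
  elim: k => [//|k]; have [c c0 fwk] := fw k; apply: contra => /eqP w0.
  move/esym/eqP: fwk; rewrite w0 lie_bracket0r scaler_eq0 oppr_eq0.
  by rewrite (gt_eqF c0).
have [|k wk] := root_space_eventually0 cartan_h (u := fun k => b + a *+ k).
  move=> j k /addrI /(congr1 (fun l : weight h => l t : K)).
  by rewrite !weight_natmul at2 => /mulrIn -> //; rewrite pnatr_eq0.
by have := wb k; rewrite wk memv0 (negPf (w0 k)).
Qed.

Lemma sl2_lower_inj a b e f t v :
    sl2_triple a e f t -> 0 < (b t : K) -> v \in root_space b ->
  [[f, v]] = 0 -> v = 0.
Proof.
by move=> tr bt vb fv; apply: (sl2_lower_raise_inj tr bt vb); rewrite fv lie_bracket0r.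
Qed.

(** Lowering and then raising is bijective on the root space of [b]. *)
Lemma sl2_raise_surj a b e f t v :
    sl2_triple a e f t -> 0 < (b t : K) -> v \in root_space b ->
  exists2 w, w \in root_space (b - a) & v = [[e, w]].
Proof.
move=> tr bt vb; have [ea fa tE at2] := tr.
pose g := (ad e \o ad f)%VF.
have gE x : g x = [[e, [[f, x]]]] by rewrite comp_lfunE !adE.
have g0 : (root_space b :&: lker g)%VS = 0%VS.
  apply/eqP; rewrite -subv0; apply/subvP => x; rewrite memv_cap memv_ker memv0 gE.
  by move=> /andP[xb /eqP /(sl2_lower_raise_inj tr bt xb) ->].
have lower x : x \in root_space b -> [[f, x]] \in root_space (b - a).
  by rewrite addrC; apply: root_space_bracket.
have gb : (g @: root_space b <= root_space b)%VS.
  apply/subvP => _ /memv_imgP[x /lower xb ->]; rewrite gE -(subrKC a b) addrC.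
  by rewrite addrC; apply: root_space_bracket.
have /eqP gbE : (g @: root_space b)%VS == root_space b.
  by rewrite -(dimv_leqif_eq gb) limg_dim_eq.
move: vb; rewrite -gbE => /memv_imgP[x /lower xb ->].
by exists [[f, x]]; rewrite ?gE.
Qed.

(** As [[f, x]] lies in [h] for [x] of weight [a], lowering and then raising sends
    the root space of [a] into the line of [e], and it is injective there. *)
Lemma sl2_root_line a e f t : sl2_triple a e f t -> root_space a = <[e]>%VS.
Proof.
move=> tr; have [ea fa tE at2] := tr.
have ete : [[vsval t, e]] = 2%:R *: e.
  by move/root_spaceP: ea => ->; rewrite at2.
apply/vspaceP => x; apply/idP/vlineP => [xa|[c ->] ]; last exact: (memvZ c ea).
have /vsprojK fxE : [[f, x]] \in h.
  by rewrite -(root_space0 cartan_h) -(addNr a); exact: root_space_bracket fa xa.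
pose c := (a (vsproj h [[f, x]]) : K).
have efx : [[e, [[f, x]]]] = - c *: e.
  by rewrite lie_bracketC -fxE; move/root_spaceP: ea => ->; rewrite scaleNr.
(* On [e] itself the operator is multiplication by 2. *)
exists (- c / 2%:R); apply/eqP; rewrite -subr_eq0; apply/eqP.
apply: (sl2_lower_raise_inj tr (b := a)); first by rewrite at2 ltr0n.
  exact: memvB xa (memvZ _ ea).
rewrite -scaleNr lie_bracketDr lie_bracketZr lie_bracketDr lie_bracketZr efx.
rewrite (lie_bracketC f e) -tE lie_bracketNr -lie_bracketC.
rewrite ete scalerA -scalerDl mulNr mulfVK ?pnatr_eq0 //.
by rewrite subrr scale0r.
Qed.

Lemma sl2_triple_neq0 a e f t : sl2_triple a e f t -> e != 0.
Proof.
move=> [_ _ tE at2]; apply/eqP => e0; move: tE; rewrite e0 lie_bracket0l.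
rewrite -(linear0 (@vsval _ _ h)) => /subvs_inj t0.
by move/eqP: at2; rewrite t0 linear0 eq_sym pnatr_eq0.
Qed.

(** The coroot is determined by the root. *)
Lemma sl2_triple_coroot a e f t e' f' t' :
  sl2_triple a e f t -> sl2_triple a e' f' t' -> t' = t.
Proof.
move=> tr tr'; have [ea fa tE at2] := tr; have [ea' fa' tE' at2'] := tr'.
have /vlineP[c e'E] : e' \in <[e]>%VS by rewrite -(sl2_root_line tr).
have /vlineP[d f'E] : f' \in <[f]>%VS by rewrite -(sl2_root_line (sl2_triple_opp tr)).
have t'E : t' = (c * d) *: t.
  apply: subvs_inj; rewrite linearZ /= tE tE' e'E f'E.
  by rewrite lie_bracketZl lie_bracketZr scalerA.
have : (c * d) * 2%:R = 1 * 2%:R :> K.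
  by rewrite mul1r -{2}at2' t'E linearZ /= at2.
by move/mulIf; rewrite t'E pnatr_eq0 => -> //; rewrite scale1r.
Qed.

End Sl2.

(** * Generation by simple root vectors *)

Section Cone.
Context {K : numFieldType} {L : lieAlgType K} (h : {vspace L}).
Hypothesis cartan_h : cartan_subalgebra h.
Context {n : nat}.
Implicit Types (alpha : 'I_n -> weight h) (t : 'I_n -> subvs_of h)
  (e f : 'I_n -> L) (c : 'I_n -> nat).

(** Every non-zero combination of the [alpha j] with natural coefficients [c] is
    positive on some [t i] with [c i] non-zero. When the [t i] are the coroots of
    the [alpha i], this is the positivity of the Cartan matrix. *)
Definition coroot_positive alpha t : Prop :=
  forall c, (exists i, (0 < c i)%N) ->
  exists2 i, (0 < c i)%N & 0 < ((\sum_j alpha j *+ c j) (t i) : K).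

Lemma coroot_positive_opp alpha t : coroot_positive alpha t ->
  coroot_positive (fun i => - alpha i) (fun i => - t i).
Proof.
move=> pos c /pos[i ci ai]; exists i => //.
rewrite linearN /= -(eq_bigr _ (fun j _ => esym (mulNrn (alpha j) (c j)))).
by rewrite sumrN opp_lfunE opprK.
Qed.

(** Induction on the number of terms of a non-empty sum of [alpha i], by removing
    one that occurs in the sum and whose [t i] is positive on it. *)
Lemma cone_induction alpha t (P : weight h -> Prop) :
    coroot_positive alpha t -> (forall i, P (alpha i)) ->
    (forall i (b : weight h), 0 < (b (t i) : K) -> P (b - alpha i) -> P b) ->
  forall c, (exists i, (0 < c i)%N) -> P (\sum_j alpha j *+ c j).
Proof.
move=> pos P1 PS c; move: {2}(\sum_j c j)%N (leqnn (\sum_j c j)%N) => m.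
elim: m c => [|m IH] c cm c0.
  by case: c0 cm => i ci; rewrite leqn0 (bigD1 i) //= addn_eq0 -leqn0 leqNgt ci.
have [i ci ai] := pos c c0.
pose c' j := (c j - (j == i))%N.
have cE j : c j = (c' j + (j == i))%N.
  by rewrite /c'; case: eqP => [->|_]; rewrite ?subnK // subn0 addn0.
have aE : \sum_j alpha j *+ c j = \sum_j alpha j *+ c' j + alpha i.
  rewrite -[in RHS](_ : \sum_j alpha j *+ (j == i) = alpha i).
    by rewrite -big_split; apply: eq_bigr => j _; rewrite cE mulrnDr.
  by rewrite (bigD1 i) //= eqxx big1 ?addr0 // => j /negPf ->.
have [c'0|/forallPn[j] ] := boolP [forall j, c' j == 0%N].
  by rewrite aE big1 ?add0r // => j _; rewrite (eqP (forallP c'0 j)) mulr0n.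
rewrite -lt0n => c'j; apply: (PS i) => //; rewrite aE addrK.
apply: IH; last by exists j.
rewrite -ltnS (leq_trans _ cm) // (eq_bigr _ (fun j _ => cE j)) big_split /=.
by rewrite [X in (_ + X)%N](bigD1 i) //= eqxx addnA addn1 ltnS leq_addr.
Qed.

Lemma cone_root_dim alpha e f t :
    (forall i, sl2_triple (alpha i) (e i) (f i) (t i)) -> coroot_positive alpha t ->
  forall c, (exists i, (0 < c i)%N) ->
    (\dim (root_space (\sum_j alpha j *+ c j)%R) <= 1)%N.
Proof.
move=> tr pos; apply: (cone_induction (P := fun b => \dim (root_space b) <= 1)%N pos)
  => [i|i b bt].
  by rewrite (sl2_root_line cartan_h (tr i)) dim_vline leq_b1.
apply: leq_trans; rewrite -(limg_dim_eq (f := ad (f i))).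
  apply/dimvS/subvP => _ /memv_imgP[x xb ->]; rewrite adE addrC.
  by have [_ fa _ _] := tr i; exact: root_space_bracket fa xb.
apply/eqP; rewrite -subv0; apply/subvP => x; rewrite memv_cap memv_ker adE memv0.
by move=> /andP[xb /eqP /(sl2_lower_inj cartan_h (tr i) bt xb) ->].
Qed.

(** A root space of a non-empty sum of [alpha i] is contained in every subspace that
    contains the [e i] and is stable under the [ad (e i)]. *)
Lemma cone_root_generated alpha e f t (P : L -> Prop) :
    (forall i, sl2_triple (alpha i) (e i) (f i) (t i)) -> coroot_positive alpha t ->
    (forall a x y, P x -> P y -> P (a *: x + y)) -> P 0 ->
    (forall i x, P x -> P [[e i, x]]) -> (forall i, P (e i)) ->
  forall c, (exists i, (0 < c i)%N) ->
    {in root_space (\sum_j alpha j *+ c j), forall x, P x}.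
Proof.
move=> tr pos Plin P0 Pe Pe1.
apply: (cone_induction (P := fun b => {in root_space b, forall x, P x}) pos)
  => [i x|i b bt IH x xb].
  rewrite (sl2_root_line cartan_h (tr i)) => /vlineP[a ->].
  by rewrite -[_ *: _]addr0; apply: Plin.
by have [w /IH Pw ->] := sl2_raise_surj cartan_h (tr i) bt xb; apply: Pe.
Qed.

End Cone.

(** The [alpha i] are the simple roots: [alpha_inj] is their freeness over the
    naturals, and [alpha_root] says that each root is positive or negative. *)
Section Generation.
Context {K : numFieldType} {L : lieAlgType K} (h : {vspace L}).
Hypothesis cartan_h : cartan_subalgebra h.
Context {n : nat}.
Variables (alpha : 'I_n -> weight h) (t : 'I_n -> subvs_of h) (e f : 'I_n -> L).
Hypothesis tr : forall i, sl2_triple (alpha i) (e i) (f i) (t i).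
Hypothesis pos : coroot_positive alpha t.
Hypothesis alpha_inj : forall c d : 'I_n -> nat,
  \sum_j alpha j *+ c j = \sum_j alpha j *+ d j -> c =1 d.
Hypothesis alpha_root : forall l : weight h, is_root l ->
  (exists c : 'I_n -> nat, l = \sum_j alpha j *+ c j) \/
  (exists c : 'I_n -> nat, - l = \sum_j alpha j *+ c j).

Lemma alpha_sum1 i : \sum_j alpha j *+ (j == i) = alpha i.
Proof. by rewrite (bigD1 i) //= eqxx big1 ?addr0 // => j /negPf ->. Qed.

Lemma alpha_diff i j (c : 'I_n -> nat) :
  i != j -> alpha i - alpha j <> \sum_k alpha k *+ c k.
Proof.
move=> ij /eqP; rewrite subr_eq -(alpha_sum1 i) -(alpha_sum1 j) -big_split /=.
rewrite -(eq_bigr _ (fun k _ => mulrnDr _ _ _)) => /eqP /alpha_inj /(_ j).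
by rewrite eqxx eq_sym (negPf ij) addn1.
Qed.

(** A difference of two distinct simple roots is not a root. *)
Lemma mixed_bracket i j : i != j -> [[e i, f j]] = 0.
Proof.
move=> ij; have [ei _ _ _] := tr i; have [_ fj _ _] := tr j.
have efij := root_space_bracket ei fj.
apply/eqP; apply: contrapT => /negP ef0.
have aij : alpha i - alpha j != 0.
  rewrite subr_eq0 -!alpha_sum1; apply/eqP => /alpha_inj /(_ i).
  by rewrite eqxx (negPf ij).
have /alpha_root : is_root (alpha i - alpha j).
  by rewrite /is_root aij; apply/vspace0P; exists [[e i, f j]].
by case=> [] [c]; rewrite ?opprB; apply: alpha_diff => //; rewrite eq_sym.
Qed.

(** Membership in the smallest subspace that contains [v] and is stable under the
    raising operators [ad (e i)]. *)
Inductive raised (v : L) : L -> Prop :=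
  | raised_base : raised v v
  | raised_zero : raised v 0
  | raised_lin a x y : raised v x -> raised v y -> raised v (a *: x + y)
  | raised_step i x : raised v x -> raised v [[e i, x]].

(** In a simple Lie algebra, a non-zero weight vector killed by the lowering
    operators generates everything under the raising operators: what it generates
    is stable under the raising and the lowering operators and under [h], hence
    is an ideal. *)
Lemma lowest_vector_generates (b : weight h) (v : L) :
    simple_lie L -> v \in root_space b -> v != 0 -> (forall i, [[f i, v]] = 0) ->
  forall x, raised v x.
Proof.
move=> [_ simple] vb v0 fv.
have hW s x : s \in h -> raised v x -> raised v [[s, x]].
  move=> sh; elim=> [||a y z _ IHy _ IHz|i y Wy IHy].
  - rewrite -(vsprojK sh); move/root_spaceP: vb => ->.
    by rewrite -[_ *: _]addr0; apply: raised_lin; constructor.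
  - by rewrite lie_bracket0r; constructor.
  - by rewrite lie_bracketDr lie_bracketZr; apply: raised_lin.
  rewrite lie_bracket_derivation; have [/root_spaceP ei _ _ _] := tr i.
  rewrite -{1}(vsprojK sh) ei lie_bracketZl; apply: raised_lin; exact: raised_step.
have fW i x : raised v x -> raised v [[f i, x]].
  elim=> [||a y z _ IHy _ IHz|j y Wy IHy].
  - by rewrite fv; constructor.
  - by rewrite lie_bracket0r; constructor.
  - by rewrite lie_bracketDr lie_bracketZr; apply: raised_lin.
  rewrite lie_bracket_derivation -[X in X + _]scale1r.
  apply: raised_lin; last exact: raised_step.
  apply: hW => //; rewrite lie_bracketC memvN.
  have [<-|ji] := eqVneq j i; last by rewrite mixed_bracket ?mem0v.
  by have [_ _ <- _] := tr j; apply: subvsP.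
(* The elements that preserve what [v] generates form a subalgebra. *)
pose G y := forall x, raised v x -> raised v [[y, x]].
have Glin a y z : G y -> G z -> G (a *: y + z).
  move=> Gy Gz x Wx; rewrite lie_bracketDl lie_bracketZl.
  by apply: raised_lin; [apply: Gy|apply: Gz].
have G0 : G 0 by move=> x _; rewrite lie_bracket0l; constructor.
have Gbr y z : G y -> G z -> G [[y, z]].
  move=> Gy Gz x Wx.
  have -> : [[[[y, z]], x]] = -1 *: [[z, [[y, x]]]] + [[y, [[z, x]]]].
    by rewrite (lie_bracket_derivation y z) scaleN1r addrC addrK.
  by apply: raised_lin; [apply/Gz/Gy|apply/Gy/Gz].
have Ge i : G (e i) by move=> x; apply: raised_step.
have Gf i : G (f i) by move=> x; apply: fW.
have Groot (l : weight h) : {in root_space l, forall y, G y}.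
  move=> y yl; have [->|y0] := eqVneq y 0; first exact: G0.
  have [l0|l0] := eqVneq l 0.
    have yh : y \in h by rewrite -(root_space0 cartan_h); exact: mem_root_space_eq l0 yl.
    by move=> x; apply: hW.
  have /alpha_root : is_root l by rewrite /is_root l0; apply/vspace0P; exists y.
  have nz c : \sum_j alpha j *+ c j != 0 -> exists i, (0 < c i)%N.
    apply: contraNP => no; rewrite big1 // => i _; case: (posnP (c i)) => [->//|ci].
    by case: no; exists i.
  case=> [] [c lE].
    have c0 : exists i, (0 < c i)%N by apply: nz; rewrite -lE.
    rewrite lE in yl; apply: (cone_root_generated cartan_h tr pos Glin G0) c0 _ yl => //.
    by move=> i x; apply: Gbr.
  have c0 : exists i, (0 < c i)%N by apply: nz; rewrite -lE oppr_eq0.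
  have lE' : l = \sum_j (- alpha j) *+ c j.
    by rewrite -[LHS]opprK lE -sumrN; apply: eq_bigr => j _; rewrite mulNrn.
  rewrite lE' in yl.
  apply: (cone_root_generated cartan_h (fun i => sl2_triple_opp (tr i))
            (coroot_positive_opp pos) Glin G0) c0 _ yl => //.
  by move=> i x; apply: Gbr.
have Gall y : G y.
  have [A uA fA] := root_decomposition cartan_h.
  have := memvf y; rewrite fA => /(memv_sum_seqP uA)[x xA ->].
  rewrite big_seq; apply: (big_ind G) => // [u w Gu Gw|l lA]; last exact: Groot (xA l lA).
  by rewrite -[u]scale1r; apply: Glin.
have [|W WP] := vspace_of_pred (P := raised v) (raised_zero v).
  by move=> a x y; apply: raised_lin.
have idW : ideal W by move=> x y /WP Wy; apply/WP/Gall.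
move=> x; apply/WP; have [W0|->] := simple W idW; last exact: memvf.
have /WP : raised v v by constructor.
by rewrite W0 memv0 (negPf v0).
Qed.

(** Lowering repeatedly ends at a non-zero vector killed by all the lowering
    operators: the number of simple roots subtracted is determined by the weight,
    and there are finitely many weights. *)
Lemma exists_lowest_vector (c : 'I_n -> nat) :
    root_space (- \sum_j alpha j *+ c j) != 0%VS ->
  exists b : weight h, exists2 v, v \in root_space b & v != 0 /\ forall i, [[f i, v]] = 0.
Proof.
move=> rc; apply: contrapT => no.
have chain k : exists2 d : 'I_n -> nat, (\sum_j d j = \sum_j c j + k)%N &
    root_space (- \sum_j alpha j *+ d j) != 0%VS.
  elim: k => [|k [d dk /vspace0P[v vd v0] ] ]; first by exists c; rewrite ?addn0.
  have [i fiv] : exists i, [[f i, v]] != 0.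
    apply: contrapT => nof; apply: no; exists (- \sum_j alpha j *+ d j); exists v => //.
    by split=> // i; apply/eqP; apply: contrapT => /negP fiv; apply: nof; exists i.
  exists (fun j => d j + (j == i))%N.
    rewrite big_split /= dk addnS -addn1; congr addn.
    by rewrite (bigD1 i) //= eqxx big1 // => j /negPf ->.
  apply/vspace0P; exists [[f i, v]]; last exact: fiv.
  rewrite (eq_bigr _ (fun j _ => mulrnDr _ _ _)) big_split /= alpha_sum1 opprD addrC.
  by have [_ fi _ _] := tr i; exact: root_space_bracket fi vd.
have [u uP] := choice (fun k => let: ex_intro2 d H1 H2 := chain k in
   ex_intro (fun d => _ /\ _) d (conj H1 H2)).
have [|k] := root_space_eventually0 cartan_h (u := fun k => - \sum_j alpha j *+ u k j).
  move=> j k /oppr_inj /alpha_inj ujk; apply/eqP; rewrite -(eqn_add2l (\sum_j c j)).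
  have [<- _] := uP j; have [<- _] := uP k; apply/eqP.
  by apply: eq_bigr => i _; rewrite ujk.
by apply/eqP; have [] := uP k.
Qed.

End Generation.

(** * Positivity of the simply laced Cartan matrices *)

Section DynkinPositivity.
Implicit Types (X : dynkinADE) (n : nat).

(** For an admissible rank [n], the coordinates of a positive multiple of the sum of
    the positive roots in the basis of the simple roots: its pairing with every
    simple coroot is positive. *)
Definition dynkin_rho X n (i : nat) : nat :=
  match X with
  | DynkinA => i.+1 * (n - i)
  | DynkinD => if (i < n - 2)%N then 2 * (i.+1 * (2 * n - 2 - i)) else n * n.-1
  | DynkinE => nth 0
      (if n == 6 then [:: 16; 22; 30; 42; 30; 16]
       else if n == 7 then [:: 34; 49; 66; 96; 75; 52; 27]
       else [:: 92; 136; 182; 270; 220; 168; 114; 58]) i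
  end%N.

(** The two cases of an edge, as [dynkin_edge] is not symmetric. *)
Let adjacent X n j i := dynkin_edge X n j i || dynkin_edge X n i j.

Lemma leq_sum_orb n (P Q : pred nat) (F : nat -> nat) :
  (\sum_(i < n) (P i || Q i) * F i
    <= \sum_(i < n) P i * F i + \sum_(i < n) Q i * F i)%N.
Proof.
rewrite -big_split leq_sum //= => i _; rewrite -mulnDl leq_mul2r.
by apply/orP; right; case: (P i); case: (Q i).
Qed.

Lemma leq_sum_eq n k (b : bool) (F : nat -> nat) :
  (\sum_(i < n) ((i == k :> nat) && b) * F i <= b * F k)%N.
Proof.
have [kn|nk] := ltnP k n; last first.
  by rewrite big1 // => i _; rewrite ltn_eqF // (leq_trans (ltn_ord i)).
rewrite (bigD1 (Ordinal kn)) //= eqxx big1 ?addn0 // => i /negPf.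
by rewrite -val_eqE /= => ->.
Qed.

(** Twice each coordinate exceeds the sum of the neighbouring ones. *)
Lemma dynkin_rho_adjacent X n j : dynkin_rank X n -> (j < n)%N ->
  (\sum_(i < n) adjacent X n j i * dynkin_rho X n i < 2 * dynkin_rho X n j)%N.
Proof.
case: X => rk jn; rewrite /= in rk.
- have /leq_ltn_trans -> // :
    (\sum_(i < n) adjacent DynkinA n j i * dynkin_rho DynkinA n i
      <= true * dynkin_rho DynkinA n j.+1 + (0 < j)%N * dynkin_rho DynkinA n j.-1)%N.
    apply: leq_trans (leq_sum_orb _ (dynkin_edge DynkinA n j)
      (fun i => dynkin_edge DynkinA n i j) _) _.
    apply: leq_add.
      apply: leq_trans (leq_sum_eq n j.+1 true _).
      by apply: leq_sum => i _; rewrite andbT.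
    apply: leq_trans (leq_sum_eq n j.-1 (0 < j)%N _).
    apply: leq_sum => i _; rewrite leq_mul2r; apply/orP; right.
    by case: j jn => [|j] jn //=; rewrite eqSS eq_sym andbT.
  by rewrite /dynkin_rho; case: j jn => [|j] jn /=; nia.
- have /leq_ltn_trans -> // :
    (\sum_(i < n) adjacent DynkinD n j i * dynkin_rho DynkinD n i
      <= ((j.+1 < n.-1)%N * dynkin_rho DynkinD n j.+1
          + (j == n - 3)%N * dynkin_rho DynkinD n n.-1)
         + ((0 < j < n.-1)%N * dynkin_rho DynkinD n j.-1
          + (j == n.-1)%N * dynkin_rho DynkinD n (n - 3)))%N.
    apply: leq_trans (leq_sum_orb _ (dynkin_edge DynkinD n j)
      (fun i => dynkin_edge DynkinD n i j) _) _.
    apply: leq_add.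
      apply: leq_trans (leq_sum_orb _ (fun i => (i == j.+1) && (i < n.-1)%N)
        (fun i => (j == n - 3)%N && (i == n.-1)) _) _.
      apply: leq_add.
        apply: leq_trans (leq_sum_eq n j.+1 (j.+1 < n.-1)%N _).
        by apply: leq_sum => i _; case: eqP => [->|].
      apply: leq_trans (leq_sum_eq n n.-1 (j == n - 3)%N _).
      by apply: leq_sum => i _; rewrite andbC.
    apply: leq_trans (leq_sum_orb _ (fun i => (j == i.+1) && (j < n.-1)%N)
      (fun i => (i == n - 3)%N && (j == n.-1)) _) _.
    apply: leq_add.
      apply: leq_trans (leq_sum_eq n j.-1 (0 < j < n.-1)%N _).
      apply: leq_sum => i _; rewrite leq_mul2r; apply/orP; right.
      by case: j jn => [|j] jn //=; rewrite eqSS eq_sym.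
    exact: leq_sum_eq.
  have rho_lt i q : (q + i + 2 = 2 * n)%N -> (i < n - 2)%N ->
      dynkin_rho DynkinD n i = (2 * (i.+1 * q))%N.
    by move=> qE i_lt; rewrite /dynkin_rho i_lt; congr (2 * (_ * _))%N; lia.
  have rho_ge i : (n - 2 <= i)%N -> dynkin_rho DynkinD n i = (n * n.-1)%N.
    by move=> i_ge; rewrite /dynkin_rho ltnNge i_ge.
  have [j1|j1|j1] := ltngtP j (n - 3)%N.
  + have [k nE] : exists k, n = (j + k + 4)%N by exists (n - j - 4)%N; lia.
    have -> : (j.+1 < n.-1)%N by lia.
    have -> : (j == n.-1) = false by lia.
    have rj := rho_lt j (j + 2 * k + 6)%N.
    rewrite rj; try lia.
    have rj1 : (dynkin_rho DynkinD n j.+1 <= 2 * (j.+2 * (j + 2 * k + 5)))%N.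
      have [j2|j2] := ltnP j.+1 (n - 2)%N; last by lia.
      by rewrite (rho_lt _ (j + 2 * k + 5)%N); lia.
    case: j {rj} jn j1 nE rj1 => [|j] jn j1 nE rj1.
      by rewrite (_ : (0 < 0 < n.-1)%N = false) // !mul0n !addn0 !mul1n; nia.
    by rewrite (rho_lt j (j + 2 * k + 8)%N); lia.
  + rewrite (rho_ge j); try lia.
    have -> : (j.+1 < n.-1)%N = false by lia.
    rewrite (rho_lt (n - 3)%N (n + 1)%N); try lia.
    have [m nE] : exists m, n = (m + 4)%N by exists (n - 4)%N; lia.
    have [jE|jE] : j = n.-2 \/ j = n.-1 by lia.
      have -> : (j == n.-1) = false by lia.
      have -> : (0 < j < n.-1)%N by lia.
      have -> : j.-1 = (n - 3)%N by lia.
      by rewrite (rho_lt (n - 3)%N (n + 1)%N) ?nE /=; nia.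
    have -> : (0 < j < n.-1)%N = false by lia.
    have -> : (j == n.-1) by lia.
    by rewrite nE /=; nia.
  rewrite j1.
  have [m nE] : exists m, n = (m + 4)%N by exists (n - 4)%N; lia.
  have -> : ((n - 3).+1 < n.-1)%N by lia.
  have -> : (0 < n - 3 < n.-1)%N by lia.
  have -> : (n - 3 == n.-1)%N = false by lia.
  rewrite (rho_ge (n - 3).+1) 1?(rho_ge n.-1); try lia.
  rewrite (rho_lt (n - 3)%N (n + 1)%N); try lia.
  by rewrite (rho_lt (n - 3).-1%N (n + 2)%N); lia.
have cases : [|| n == 6, n == 7 | n == 8]%N by lia.
suff all_j : all (fun j => \sum_(i < n) adjacent DynkinE n j i * dynkin_rho DynkinE n i
    < 2 * dynkin_rho DynkinE n j)%N (iota 0 n).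
  by move/allP: all_j; apply; rewrite mem_iota.
suff : all (fun j => \sum_(0 <= i < n) adjacent DynkinE n j i * dynkin_rho DynkinE n i
    < 2 * dynkin_rho DynkinE n j)%N (iota 0 n).
  by apply: sub_all => k; rewrite big_mkord.
by rewrite unlock; case/or3P: cases => /eqP ->.
Qed.

(** Pairing the row [c A] with [dynkin_rho] gives a positive number, so some entry of
    [c A] is positive; its index has [c i > 0], since the off-diagonal entries of
    [A] are not positive. *)
Lemma dynkin_cartan_positive X n (c : 'I_n -> nat) :
    dynkin_rank X n -> (exists i, (0 < c i)%N) ->
  exists2 i, (0 < c i)%N & 0 < \sum_j dynkin_cartan X n j i *+ c j.
Proof.
move=> rk [i0 ci0].
pose d (i : 'I_n) : int := (dynkin_rho X n i)%:Z.
have Ad j : 0 < \sum_i dynkin_cartan X n j i * d i.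
  have := dynkin_rho_adjacent rk (ltn_ord j).
  rewrite -ltz_nat -subr_gt0 => /lt_le_trans; apply.
  have -> : (2 * dynkin_rho X n j)%N%:Z = \sum_i (if i == j then 2 * d i else 0).
    by rewrite -big_mkcond big_pred1_eq PoszM.
  rewrite (big_morph Posz PoszD (erefl 0%:Z)) -sumrB; apply: ler_sum => i _.
  rewrite mxE PoszM (eq_sym j); case: eqP => [->|_].
    by rewrite lerBlDr lerDl mulr_ge0.
  rewrite /adjacent; case: ifP => _; last by rewrite !mul0r subr0.
  by rewrite mul1r mulN1r sub0r.
have row : 0 < \sum_i d i * \sum_j dynkin_cartan X n j i *+ c j.
  have -> : \sum_i d i * \sum_j dynkin_cartan X n j i *+ c j
      = \sum_j (\sum_i dynkin_cartan X n j i * d i) *+ c j.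
    under eq_bigr do rewrite mulr_sumr.
    rewrite exchange_big; apply: eq_bigr => j _; rewrite -sumrMnl.
    by apply: eq_bigr => i _; rewrite mulrnAr mulrC.
  rewrite (bigD1 i0) //= ltr_wpDr //; last by rewrite pmulrn_lgt0.
  by apply: sumr_ge0 => j _; rewrite mulrn_wge0 // ltW.
have [i ai] : exists i, 0 < \sum_j dynkin_cartan X n j i *+ c j.
  apply/existsP; apply: contraLR row => /existsPn neg; rewrite -leNgt.
  by apply: sumr_le0 => i _; rewrite mulr_ge0_le0 // leNgt neg.
exists i => //; rewrite lt0n; apply: contraL ai => /eqP ci; rewrite -leNgt.
apply: sumr_le0 => j _; have [->|ji] := eqVneq j i; first by rewrite ci mulr0n.
by rewrite mulrn_wle0 // mxE (negPf ji); case: ifP.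
Qed.

End DynkinPositivity.

(** * Arrows of the quiver *)

Section Arrows.
Context {K : fieldType} {L : lieAlgType K} (h nn : {vspace L}).
Hypothesis cartan_h : cartan_subalgebra h.
Implicit Types (l a : weight h) (t : subvs_of h) (x : L).

Lemma root_sum_stable (A : seq (weight h)) t x :
  x \in (\sum_(l <- A) root_space l)%VS ->
  [[vsval t, x]] \in (\sum_(l <- A) root_space l)%VS.
Proof.
elim/big_ind: _ x => [x|U V Ut Vt x|l _ x].
- by rewrite memv0 => /eqP ->; rewrite lie_bracket0r mem0v.
- by move=> /memv_addP[u /Ut uU [w /Vt wV ->] ]; rewrite lie_bracketDr memv_add.
- by move=> xl; move/root_spaceP: (xl) => ->; apply: memvZ.
Qed.

(** The scalar [c], as an endomorphism of the line. *)
Definition scale_id (c : K^o) : 'Hom(K^o, K^o) := c *: \1%VF.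

Fact scale_id_linear : linear scale_id.
Proof. by move=> a c d; rewrite /scale_id scalerDl -scalerA. Qed.
HB.instance Definition _ :=
  GRing.isLinear.Build K K^o 'Hom(K^o, K^o) *:%R scale_id scale_id_linear.

(** There is an arrow from [l] to [l + a] for each weight [a] whose space is a line
    in [nn]: the invariant map is the coordinate along [e] of the projection on that
    line, along the sum of the other weight spaces. *)
Lemma root_arrow l a (e : L) :
    e != 0 -> root_space a = <[e]>%VS -> e \in nn ->
    (forall t x, x \in nn -> [[vsval t, x]] \in nn) ->
  @arrow (homogeneous_quiver h nn) l (l + a).
Proof.
move=> e0 aE enn nnt; have [A uA fA] := root_decomposition cartan_h.
have ea : e \in root_space a by rewrite aE memv_line.
have aA : a \in A := weight_mem uA fA ea e0.
have uA' := rem_uniq a uA.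
pose V := (\sum_(l <- rem a A) root_space l)%VS.
have aV0 : (root_space a :&: V)%VS = 0%VS.
  apply/eqP; rewrite -subv0; apply/subvP => x; rewrite memv_cap => /andP[xa].
  move=> /(memv_sum_seqP uA')[y yA xE].
  have := weight_component uA' yA xa xE.
  by rewrite mem_rem_uniqF // => ->; rewrite mem0v.
have Va0 : (V :&: root_space a)%VS = 0%VS by rewrite capvC.
have faV : fullv = (root_space a + V)%VS by rewrite fA (big_rem a).
pose pr := daddv_pi (root_space a) V.
have pr_weight t x : pr [[vsval t, x]] = (a t : K) *: pr x.
  have := memvf x; rewrite faV => /memv_addP[u ua [w wV ->] ].
  have pr0 z : z \in V -> pr z = 0.
    move=> zV; have := daddv_pi_add (w := z) aV0.
    rewrite -faV memvf (daddv_pi_id Va0 zV) -[X in _ = X]add0r => /(_ isT).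
    exact: addIr.
  rewrite lie_bracketDr !linearD /= (pr0 w wV) (pr0 _ (root_sum_stable t wV)).
  rewrite scaler0 !addr0.
  by move/root_spaceP: (ua) => ->; rewrite linearZ.
pose f := (linfun scale_id \o linfun (coord [tuple e] ord0 : L -> K^o)
           \o pr \o linfun vsval)%VF : 'Hom(subvs_of nn, 'Hom(K^o, K^o)).
have fE (x : subvs_of nn) (v : K^o) :
  f x v = (coord [tuple e] ord0 (pr (vsval x)) : K) *: v.
  rewrite /f !comp_lfunE [linfun vsval _]lfunE /=.
  by rewrite [linfun scale_id _]lfunE /= /scale_id scale_lfunE id_lfunE lfunE.
exists f.
  move=> t x v; rewrite !fE vsprojK ?nnt ?subvsP // pr_weight linearZ /=.
  rewrite add_lfunE scalerDl -!scalerA addrC; congr (_ + _).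
  by rewrite !scalerA mulrC.
move=> /lfunP/(_ (vsproj nn e)); rewrite zero_lfunE => /lfunP/(_ (1 : K^o)).
rewrite fE vsprojK // zero_lfunE (daddv_pi_id aV0 ea).
rewrite -[e in coord _ _ e](_ : [tuple e]`_(@ord0 0) = e) // coord_free.
  by rewrite eqxx scale1r => /eqP; rewrite oner_eq0.
by rewrite seq1_free.
Qed.

End Arrows.

(** * Coordinates with respect to the simple roots *)

Section SimpleRoots.
Context {K : numFieldType} {L : lieAlgType K} (h : {vspace L}) {n : nat}.
Implicit Types (D : n.-tuple (weight h)) (c d : 'I_n -> nat).

Lemma free_comb_inj (V : vectType K) (D : n.-tuple V) c d :
  free D -> \sum_i tnth D i *+ c i = \sum_i tnth D i *+ d i -> c =1 d.
Proof.
move=> /freeP fD cd i; apply/eqP; rewrite -(eqr_nat K) -subr_eq0; apply/eqP.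
apply: (fD (fun i => (c i)%:R - (d i)%:R)).
transitivity (\sum_j (tnth D j *+ c j - tnth D j *+ d j)).
  by apply: eq_bigr => j _; rewrite -tnth_nth scalerBl !scaler_nat.
by rewrite sumrB cd subrr.
Qed.

Lemma sum_perm D (s : 'S_n) c :
  \sum_j tnth D (s j) *+ c j = \sum_i tnth D i *+ c ((s^-1)%g i).
Proof.
rewrite [RHS](reindex_inj (@perm_inj _ s)) /=.
by apply: eq_bigr => j _; rewrite permK.
Qed.

Lemma coroot_triple (a : weight h) : cartan_integer a a 2%:Z ->
  exists p : L * L * subvs_of h, sl2_triple a p.1.1 p.1.2 p.2.
Proof.
case=> t [at2 [e [f [ea fa tE] ] ] ] _; exists (e, f, t); exact: And4 ea fa tE at2.
Qed.

End SimpleRoots.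

(** * The tangent bundle *)

(** Here [alpha], [t], [e] and [f] are the simple roots, with their coroots and root
    vectors; [nnP] and [nn_stable] are what is needed of [nn] as the sum of the
    positive root spaces. *)
Section TangentBundle.
Context {K : numFieldType} {L : lieAlgType K} (h nn p : {vspace L}) {n : nat}.
Variables (alpha : 'I_n -> weight h) (t : 'I_n -> subvs_of h) (e f : 'I_n -> L).
Hypothesis simpleL : simple_lie L.
Hypothesis cartan_h : cartan_subalgebra h.
Hypothesis tr : forall i, sl2_triple (alpha i) (e i) (f i) (t i).
Hypothesis pos : coroot_positive alpha t.
Hypothesis alpha_inj : forall c d : 'I_n -> nat,
  \sum_j alpha j *+ c j = \sum_j alpha j *+ d j -> c =1 d.
Hypothesis alpha_root : forall l : weight h, is_root l ->
  (exists c : 'I_n -> nat, l = \sum_j alpha j *+ c j) \/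
  (exists c : 'I_n -> nat, - l = \sum_j alpha j *+ c j).
Hypothesis nnP : forall l : weight h, is_root l ->
  (exists c : 'I_n -> nat, l = \sum_j alpha j *+ c j) -> (root_space l <= nn)%VS.
Hypothesis nn_stable : forall (s : subvs_of h) x, x \in nn -> [[vsval s, x]] \in nn.
Hypothesis bp : parabolic (h + nn)%VS p.

Let hp : (h <= p)%VS.
Proof. by apply: subv_trans bp.2; apply: addvSl. Qed.

Let nnp : (nn <= p)%VS.
Proof. by apply: subv_trans bp.2; apply: addvSr. Qed.

(** The vertices of the quiver of the tangent bundle. *)
Lemma support_tangentP (l : weight h) :
  reflect (exists2 x, x \in root_space l & x \notin p)
          (@Defs.support _ _ h _ (tangent_bundle bp) l).
Proof.
rewrite /Defs.support /= (tangent_weight_space cartan_h _ bp.1 hp).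
apply: (iffP (vspace0P _)) => [ [u /memv_imgP[x xl ->] nz]|[x xl xp] ].
  by exists x; rewrite // -(lker_quot_proj p) memv_ker.
exists (quot_proj p x); first exact: memv_img.
by rewrite -memv_ker lker_quot_proj.
Qed.

(** The vertices are negative roots, as [p] contains [h] and the positive root spaces. *)
Lemma support_tangent_negative (l : weight h) :
    @Defs.support _ _ h _ (tangent_bundle bp) l ->
  exists2 c : 'I_n -> nat, - l = \sum_j alpha j *+ c j & exists i, (0 < c i)%N.
Proof.
move=> /support_tangentP[x xl xp].
have x0 : x != 0 by apply: contraNneq xp => ->; rewrite mem0v.
have l0 : l != 0.
  apply: contraNneq xp => l0; apply: (subvP hp).
  by rewrite -(root_space0 cartan_h); exact: mem_root_space_eq l0 xl.
have lroot : is_root l by rewrite /is_root l0; apply/vspace0P; exists x.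
have [ [c lE]|[c lE] ] := alpha_root lroot.
  have lnn : (root_space l <= nn)%VS by apply: nnP => //; exists c.
  by move: xp; rewrite (subvP nnp) // (subvP lnn).
exists c => //; apply: contrapT => no.
have : - l == 0.
  rewrite lE big1 // => i _; case: (posnP (c i)) => [->//|ci].
  by case: no; exists i.
by rewrite oppr_eq0 (negPf l0).
Qed.

Lemma tangent_multiplicity_free : multiplicity_free h (tangent_bundle bp).
Proof.
move=> l Sl; apply/eqP; rewrite eqn_leq lt0n dimv_eq0 [X in _ && X]Sl andbT.
rewrite /= (tangent_weight_space cartan_h _ bp.1 hp).
have [c lE c0] := support_tangent_negative Sl.
have -> : l = \sum_j (- alpha j) *+ c j.
  by rewrite -[LHS]opprK lE -sumrN; apply: eq_bigr => j _; rewrite mulNrn.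
have := cone_root_dim cartan_h (fun i => sl2_triple_opp (tr i))
          (coroot_positive_opp pos) c0.
by apply: leq_trans; rewrite -(limg_ker_dim (quot_proj p)) leq_addl.
Qed.

Lemma tangent_connected : connected h nn (tangent_bundle bp).
Proof.
move=> x0; have [c lE _] := support_tangent_negative (valP x0).
have [|b [v vb [v0 fv] ] ] := exists_lowest_vector cartan_h tr alpha_inj (c := c).
  rewrite -lE opprK; have /support_tangentP[y yl yp] := valP x0.
  by apply/vspace0P; exists y; rewrite //; apply: contraNneq yp => ->; rewrite mem0v.
have [A uA fA] := root_decomposition cartan_h.
set Q := bundle_quiver h nn (tangent_bundle bp).
pose S := @Defs.support _ _ h _ (tangent_bundle bp).
(* The weights of the bundle that are joined to [b], with a proof for both ends
   that they are vertices. *)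
pose joined (l : weight h) := exists (Sl : S l) (Sb : S b),
  clos_refl_sym_trans (vertex Q) (@arrow Q) (exist _ l Sl) (exist _ b Sb).
pose B := [seq l <- A | `[< joined l >] ].
(* If [b] is not a vertex, then [B] is empty and [M] is [p]. *)
pose M := (p + \sum_(l <- B) root_space l)%VS.
have uB : uniq B by rewrite filter_uniq.
have raiseM i x : x \in M -> [[e i, x]] \in M.
  have [ei _ _ at2] := tr i; have e0 := sl2_triple_neq0 (tr i).
  have aroot : is_root (alpha i).
    apply/andP; split; last by apply/vspace0P; exists (e i).
    apply/eqP => a0; move: at2; rewrite a0 zero_lfunE => /eqP.
    by rewrite eq_sym pnatr_eq0.
  have einn : e i \in nn.
    apply: subvP (nnP aroot _) _ ei.
    by exists (fun j => (j == i) : nat); rewrite alpha_sum1.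
  move=> /memv_addP[y yp [z /(memv_sum_seqP uB)[w wB ->] ->] ].
  rewrite lie_bracketDr rpredD //.
    by apply: (subvP (addvSl _ _)); apply: bp.1; rewrite // (subvP nnp).
  rewrite linear_sum big_seq rpred_sum // => l lB /=.
  have wl := wB l lB; have ewl := root_space_bracket ei wl.
  have [ep|ep] := boolP ([[e i, w l]] \in p); first exact: subvP (addvSl _ _) _ ep.
  have Sl' : S (alpha i + l) by apply/support_tangentP; exists [[e i, w l]].
  apply: (subvP (addvSr _ _)).
  suff lB' : alpha i + l \in B.
    by rewrite (big_rem _ lB') /=; apply: subvP (addvSl _ _) _ ewl.
  rewrite mem_filter; apply/andP; split.
    apply/asboolP; move: lB; rewrite mem_filter => /andP[/asboolP[Sl [Sb lb] ] _].
    exists Sl', Sb; apply: rst_trans lb; apply/rst_sym/rst_step => /=.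
    rewrite addrC; apply: (root_arrow cartan_h _ e0 _ einn nn_stable).
    exact: sl2_root_line (tr i).
  apply: weight_mem uA fA ewl _.
  by apply: contraNneq ep => ->; rewrite mem0v.
have vM : v \in M.
  have [vp|vp] := boolP (v \in p); first exact: subvP (addvSl _ _) _ vp.
  have Sb : S b by apply/support_tangentP; exists v.
  apply: (subvP (addvSr _ _)).
  suff bB : b \in B by rewrite (big_rem _ bB) /=; apply: subvP (addvSl _ _) _ vb.
  rewrite mem_filter (weight_mem uA fA vb v0) andbT; apply/asboolP.
  by exists Sb, Sb; apply: rst_refl.
have Mf y : y \in M.
  elim: (lowest_vector_generates cartan_h tr pos alpha_inj alpha_root simpleL vb v0 fv y).
  - exact: vM.
  - exact: mem0v.
  - by move=> a u w _ uM _ wM; rewrite rpredD ?rpredZ.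
  - by move=> i u _; apply: raiseM.
(* A vector of weight [l] outside [p] lies in [M]; modulo [p] it must then be one
   of the summands indexed by [B]. *)
have all_joined (x : vertex Q) : joined (proj1_sig x).
  case: x => l Sl /=; have /support_tangentP[y yl yp] := Sl.
  have /memv_addP[q qp [z /(memv_sum_seqP uB)[w wB zE] yE] ] := Mf y.
  have projE : quot_proj p y = \sum_(m <- B) quot_proj p (w m).
    rewrite yE linearD /= -linear_sum zE /=.
    have /eqP -> : quot_proj p q == 0 by rewrite -memv_ker lker_quot_proj.
    by rewrite add0r.
  have projP (m : weight h) x : x \in root_space m ->
      quot_proj p x \in weight_space (tangent_act p) m.
    by rewrite (tangent_weight_space cartan_h _ bp.1 hp); apply: memv_img.
  have := weight_component uB (fun m mB => projP m _ (wB m mB)) (projP l y yl) projE.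
  case: ifP => [|_ /eqP]; last by rewrite -memv_ker lker_quot_proj (negPf yp).
  by rewrite mem_filter => /andP[/asboolP].
move=> y0; have [Sx [Sb xb] ] := all_joined x0; have [Sy [Sb' yb] ] := all_joined y0.
case: x0 y0 Sx Sy xb yb {lE} => [x Sx0] [y Sy0] /= Sx Sy.
rewrite (bool_irrelevance Sx Sx0) (bool_irrelevance Sy Sy0) (bool_irrelevance Sb' Sb).
by move=> xb yb; apply: rst_trans xb _; apply: rst_sym.
Qed.

End TangentBundle.

Theorem theorem4p2 (R : realType) (L : lieAlgType R[i])
    (h : {vspace L}) (n : nat) (D : n.-tuple (weight h)) (nn p : {vspace L})
    (simpleL : simple_lie L)
    (cartan_h : cartan_subalgebra h)
    (simple_D : simple_roots D)
    (ADE_D : type_ADE D)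
    (nnE : positive_part D nn)
    (bp : parabolic (h + nn)%VS p) :
  multiplicity_free h (tangent_bundle bp) /\
  connected h nn (tangent_bundle bp).
Proof.
have [freeD _ rootD] := simple_D; have [X [rankX [s cartanD] ] ] := ADE_D.
have [Phi [PhiP nnPhi] ] := nnE.
(* The simple roots, numbered as the rows of the Cartan matrix. *)
pose alpha i := tnth D (s i).
have [q qP] : exists q : 'I_n -> L * L * subvs_of h,
    forall i, sl2_triple (alpha i) (q i).1.1 (q i).1.2 (q i).2.
  apply: (fin_all_exists (P := fun (i : 'I_n) (q : L * L * subvs_of h) =>
    sl2_triple (alpha i) q.1.1 q.1.2 q.2)) => i.
  apply: coroot_triple.
  by have := cartanD i i; rewrite mxE eqxx.
pose t i := (q i).2.
(* The coroot in the hypothesis on the entry [(i, j)] may depend on [i]; it is [t j]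
   by uniqueness. *)
have alphat i j : alpha i (t j) = (dynkin_cartan X n i j)%:~R :> R[i].
  have [t' [at2 [e [f [ea fa tE] ] ] ] at'] := cartanD i j.
  have tr' : sl2_triple (alpha j) e f t' by exact: And4 ea fa tE at2.
  by rewrite /t -(sl2_triple_coroot cartan_h (qP j) tr') at'.
have pos : coroot_positive alpha t.
  move=> c /(dynkin_cartan_positive rankX)[i ci ai]; exists i => //.
  rewrite sum_lfunE (eq_bigr (fun j => (dynkin_cartan X n j i *+ c j)%:~R)).
    by rewrite -[X in _ < X]rmorph_sum ltr0z.
  by move=> j _; rewrite weight_natmul alphat -rmorphMn.
have alpha_inj c d : \sum_j alpha j *+ c j = \sum_j alpha j *+ d j -> c =1 d.
  rewrite !sum_perm => /(free_comb_inj freeD) cd j.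
  by have := cd (s j); rewrite permK.
have comb l : nonneg_comb D l <-> exists c : 'I_n -> nat, l = \sum_j alpha j *+ c j.
  split=> [] [c ->]; last by exists (fun i => c ((s^-1)%g i)); rewrite sum_perm.
  exists (fun j => c (s j)); rewrite sum_perm; apply: eq_bigr => i _.
  by rewrite permKV.
have alpha_root l : is_root l ->
    (exists c : 'I_n -> nat, l = \sum_j alpha j *+ c j) \/
    (exists c : 'I_n -> nat, - l = \sum_j alpha j *+ c j).
  by move=> /rootD[] /comb; [left|right].
have nnP l : is_root l -> (exists c : 'I_n -> nat, l = \sum_j alpha j *+ c j) ->
    (root_space l <= nn)%VS.
  move=> rl /comb lD; have /PhiP lPhi : positive_root D l by [].
  by rewrite nnPhi (big_rem l) //= addvSl.
have nn_stable (r : subvs_of h) x : x \in nn -> [[vsval r, x]] \in nn.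
  by rewrite nnPhi; apply: root_sum_stable.
split; first exact: tangent_multiplicity_free qP pos alpha_root nnP bp.
exact: tangent_connected qP pos alpha_inj alpha_root nnP nn_stable bp.
Qed.
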